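(* Let $\lambda>0$, $k\in\mathbb Z_+$, $\mathbf a_1,\dots,\mathbf a_n\in\mathbb R^p$ and $y_1,\dots,y_n\in\{-1,1\}$, and let $M$ be a sufficiently large number. Let $\mathbf A\in\mathbb R^{n\times p}$ be the matrix whose $i$-th row is $y_i\mathbf a_i^\top$. Given any collection $\mathcal L\subseteq2^{[n]}$ of subsets of $[n]=\{1,\dots,n\}$, consider the formulation (R): $$\min_{\mathbf w,\mathbf W,\mathbf z,\{\mathbf g^L\}_{L\in\mathcal L}}\ \langle\mathbf I_{p\times p},\mathbf W\rangle+\lambda\sum_{i=1}^nz_i$$ subject to, for all $L\in\mathcal L$, $$\mathbf 1_L-\mathbf A_{L,p}\mathbf w\le\mathbf g^L,\qquad \begin{pmatrix}\sum_{i\in L}z_i&-(\mathbf g^L)^\top\\-\mathbf g^L&\mathbf 1_L\mathbf 1_L^\top-\mathbf A_{L,p}\mathbf w\mathbf 1_L^\top-\mathbf 1_L\mathbf w^\top\mathbf A_{L,p}^\top+\mathbf A_{L,p}\mathbf W\mathbf A_{L,p}^\top\end{pmatrix}\in\mathcal S_+^{|L|+1},$$ and $$\mathbf W-\mathbf w\mathbf w^\top\in\mathcal S_+^p,\quad \mathbf w\in\mathbb R^p,\ \mathbf W\in\mathbb R^{p\times p},\ \mathbf z\in[0,1]^n,\ \mathbf g^L\in\mathbb R^L\ (L\in\mathcal L).$$ Then (R) is a convex relaxation of the mixed-integer problem $$\min_{\mathbf w\in\mathbb R^p,\ \mathbf z\in\{0,1\}^n}\ \|\mathbf w\|_2^2+\lambda\sum_{i=1}^nz_i\quad\text{s.t.}\quad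 y_i(\mathbf a_i^\top\mathbf w)\ge1-Mz_i\ \ \forall i\in[n].$$ Moreover, if the constraint $\sum_{i=1}^nz_i\le k$ is added to (R) and the term $\lambda\sum_{i=1}^nz_i$ is removed from its objective, the ensuing formulation is a convex relaxation of $$\min_{\mathbf w\in\mathbb R^p,\ \mathbf z\in\{0,1\}^n}\ \|\mathbf w\|_2^2\quad\text{s.t.}\quad y_i(\mathbf a_i^\top\mathbf w)\ge1-Mz_i\ \ \forall i\in[n],\quad \sum_{i=1}^nz_i\le k.$$
   Context: The two mixed-integer problems are big-M formulations of support vector machine problems with 0-1 loss for labeled data $(\mathbf a_i,y_i)$, $i\in[n]$, in penalized and cardinality-constrained form. In both, $M$ is a sufficiently large number (the big-M constant): $z_i=0$ forces $y_i(\mathbf a_i^\top\mathbf w)\ge1$, while $z_i=1$ allows point $i$ to lie in the margin or to be misclassified. ''Convex relaxation'' of a mixed-integer minimization problem means: a minimization problem with convex feasible set and convex objective function such that every feasible point $(\mathbf w,\mathbf z)$ of the mixed-integer problem extends (by a choice of the additional variables, here $\mathbf W$ and $\{\mathbf g^L\}$) to a feasible point of the relaxation whose objective value is at most the objective value of $(\mathbf w,\mathbf z)$ in the mixed-integer problem. $\mathcal S_+^m$ is the cone of symmetric positive semidefinite $m\times m$ real matrices; $\mathbf I_{p\times p}$ is the identity matrix; $\langle\mathbf B,\mathbf C\rangle=\sum_{i,j}B_{ij}C_{ij}$; $2^{[n]}$ is the set of all subsets of $[n]$; $\mathbb R^L$ is the space of real vectors indexed by $L$; $\mathbf 1_L\in\mathbb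 R^L$ is the all-ones vector; $\mathbf A_{L,p}\in\mathbb R^{L\times p}$ is the submatrix of $\mathbf A$ consisting of the rows indexed by $L$; vector inequalities are componentwise. *)

(* Defs.v *)
From HB Require Import structures.
From mathcomp Require Export all_boot all_order all_algebra.
From mathcomp Require Export boolp classical_sets reals convex.

Set Implicit Arguments.
Unset Strict Implicit.
Unset Printing Implicit Defensive.

Import Order.TTheory GRing.Theory Num.Theory.

Local Open Scope classical_set_scope.
Local Open Scope ring_scope.

Definition psdmx (R : realType) (m : nat) (B : 'M[R]_m) : Prop :=
  B^T = B /\ forall x : 'cV[R]_m, 0 <= (x^T *m B *m x) 0 0.

Definition mxinner (R : realType) (m n : nat) (B C : 'M[R]_(m, n)) : R :=
  \sum_(i < m) \sum_(j < n) B i j * C i j.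

(* The Euclidean norm, squared; `|w| on matrices is the sup norm. *)
Definition sqnorm2 (R : realType) (m : nat) (w : 'cV[R]_m) : R :=
  \sum_(j < m) w j 0 ^+ 2.

Record min_problem (R : realType) (V : Type) := MinProblem {
  feasible : set V;
  objective : V -> R }.

(* X: the variables of the original problem; Y: the additional variables. *)
Definition convex_relaxation (R : realType) (X Y : lmodType R)
    (Q : min_problem R (X * Y)%type) (P : min_problem R X) : Prop :=
  [/\ @convex_set R (X * Y)%type (feasible Q),
      @convex_function R (X * Y)%type setT (objective Q) &
      forall x : X, feasible P x ->
        exists y : Y,
          feasible Q (x, y) /\ objective Q (x, y) <= objective P x].

(* (w, z) *)
Notation svm_vars R p n := ('cV[R]_p * 'cV[R]_n)%type.

Definition bigM_feasible (R : realType) (n p : nat) (a : 'I_n -> 'cV[R]_p)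
    (y : 'I_n -> R) (M : R) : set (svm_vars R p n) :=
  [set x : svm_vars R p n | let: (w, z) := x in
    (forall i, z i 0 = 0 \/ z i 0 = 1) /\
    (forall i, y i * ((a i)^T *m w) 0 0 >= 1 - M * z i 0)].

Definition bigM_penalized (R : realType) (n p : nat) (a : 'I_n -> 'cV[R]_p)
    (y : 'I_n -> R) (M lambda : R) : min_problem R (svm_vars R p n) :=
  MinProblem (bigM_feasible a y M)
    (fun x : svm_vars R p n => let: (w, z) := x in
      sqnorm2 w + lambda * \sum_(i < n) z i 0).

Definition bigM_cardinality (R : realType) (n p : nat) (a : 'I_n -> 'cV[R]_p)
    (y : 'I_n -> R) (M : R) (k : nat) : min_problem R (svm_vars R p n) :=
  MinProblem
    (bigM_feasible a y M `&`
       [set x : svm_vars R p n | let: (w, z) := x in \sum_(i < n) z i 0 <= k%:R])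
    (fun x : svm_vars R p n => let: (w, z) := x in sqnorm2 w).

Definition data_mx (R : realType) (n p : nat) (a : 'I_n -> 'cV[R]_p)
    (y : 'I_n -> R) : 'M[R]_(n, p) :=
  \matrix_(i, j) (y i * a i j 0).

(* The product over L in LL of the spaces R^L, uncurried. The coordinates of
   R^L are numbered by 'I_#|L| through enum_val. *)
Notation gfamily R n LL :=
  {ffun {L : {L : {set 'I_n} | L \in LL} & 'I_#|val L|} -> R^o}.

(* (W, {g^L}) *)
Notation aux_vars R p n LL := ('M[R]_p * gfamily R n LL)%type.

Definition gvec (R : realType) (n : nat) (LL : {set {set 'I_n}})
    (g : gfamily R n LL) (L : {L : {set 'I_n} | L \in LL}) :
    'cV[R]_#|val L| :=
  \col_j g (@Tagged _ L (fun L => 'I_#|val L|) j).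

Definition rows_in (R : realType) (n p : nat) (L : {set 'I_n})
    (A : 'M[R]_(n, p)) : 'M[R]_(#|L|, p) :=
  rowsub (@enum_val _ (mem L)) A.

Definition ones (R : realType) (m : nat) : 'cV[R]_m := const_mx 1.
Arguments ones {R m}.

Definition lifted_mx (R : realType) (n p : nat) (A : 'M[R]_(n, p))
    (L : {set 'I_n}) (w : 'cV[R]_p) (W : 'M[R]_p) (z : 'cV[R]_n)
    (g : 'cV[R]_#|L|) : 'M[R]_(1 + #|L|) :=
  let AL := rows_in L A in
  block_mx
    (\sum_(i in L) z i 0)%:M   (- g^T)
    (- g)                      (ones *m ones^T - AL *m w *m ones^T
                                - ones *m w^T *m AL^T + AL *m W *m AL^T).

Definition relax_feasible (R : realType) (n p : nat) (a : 'I_n -> 'cV[R]_p)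
    (y : 'I_n -> R) (LL : {set {set 'I_n}}) :
    set (svm_vars R p n * aux_vars R p n LL)%type :=
  [set v : svm_vars R p n * aux_vars R p n LL | let: ((w, z), (W, g)) := v in
    let A := data_mx a y in
    [/\ forall L : {L : {set 'I_n} | L \in LL},
          (forall j, (ones - rows_in (val L) A *m w) j 0 <= gvec g L j 0) /\
          psdmx (lifted_mx A w W z (gvec g L)),
        psdmx (W - w *m w^T) &
        forall i, 0 <= z i 0 <= 1]].

Definition relax_penalized (R : realType) (n p : nat) (a : 'I_n -> 'cV[R]_p)
    (y : 'I_n -> R) (lambda : R) (LL : {set {set 'I_n}}) :
    min_problem R (svm_vars R p n * aux_vars R p n LL)%type :=
  MinProblem (@relax_feasible R n p a y LL)
    (fun v : svm_vars R p n * aux_vars R p n LL => let: ((w, z), (W, g)) := v in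
      mxinner 1%:M W + lambda * \sum_(i < n) z i 0).

Definition relax_cardinality (R : realType) (n p : nat) (a : 'I_n -> 'cV[R]_p)
    (y : 'I_n -> R) (k : nat) (LL : {set {set 'I_n}}) :
    min_problem R (svm_vars R p n * aux_vars R p n LL)%type :=
  MinProblem
    (@relax_feasible R n p a y LL `&`
       [set v : svm_vars R p n * aux_vars R p n LL | let: ((w, z), (W, g)) := v in \sum_(i < n) z i 0 <= k%:R])
    (fun v : svm_vars R p n * aux_vars R p n LL => let: ((w, z), (W, g)) := v in mxinner 1%:M W).

(* Main.v *)
Require Import Defs.
From mathcomp Require Import interval_inference.
From mathcomp Require Import ring lra.
Import Order.TTheory GRing.Theory Num.Theory.
Local Open Scope ring_scope.

(**
  Given a feasible [(w, z)] with [z] binary, take [W = w w^T] and write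
  [u = 1_L - A_L w]. The lower right block of the matrix attached to [L] is then
  [u u^T]. Choose [g^L = c u], where [c = 1] if some [z_i] with [i] in [L] equals
  one and [c = 0] otherwise. If [c = 0] then all the constraints indexed by [L]
  are enforced, so [u <= 0 = g^L]. Since [c] is 0 or 1 and is at most the sum of
  the [z_i] over [L], the matrix is the sum of the Gram matrix of [(-c, u)] and a
  nonnegative multiple of the Gram matrix of [(1, 0)].

  For convexity, the matrices attached to the sets [L] are affine in the
  variables, and [(w, W) |-> W - w w^T] is concave in the Loewner order.
*)

Section PositiveSemidefinite.
Context {R : realType} {m : nat}.
Implicit Types (B C : 'M[R]_m) (v : 'cV[R]_m).

Lemma psdmxD B C : psdmx B -> psdmx C -> psdmx (B + C).
Proof.
move=> [Bsym Bge0] [Csym Cge0]; split; first by rewrite linearD /= Bsym Csym.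
by move=> x; rewrite mulmxDr mulmxDl mxE addr_ge0.
Qed.

Lemma psdmxZ (t : R) B : 0 <= t -> psdmx B -> psdmx (t *: B).
Proof.
move=> t_ge0 [Bsym Bge0]; split; first by rewrite linearZ /= Bsym.
by move=> x; rewrite -scalemxAr -scalemxAl mxE mulr_ge0.
Qed.

Lemma psdmx0 : psdmx (0 : 'M[R]_m).
Proof. by split=> [|x]; rewrite ?trmx0 // mulmx0 mul0mx mxE. Qed.

Lemma psdmx_gram v : psdmx (v *m v^T).
Proof.
split=> [|x]; first by rewrite trmx_mul trmxK.
rewrite mulmxA -mulmxA mxE big_ord1.
(* A 1 x 1 matrix is its own transpose, so the quadratic form is a square. *)
have -> : (v^T *m x) 0 0 = (x^T *m v) 0 0.
  by rewrite -[in RHS](trmxK v) -trmx_mul [RHS]mxE.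
exact: sqr_ge0.
Qed.

End PositiveSemidefinite.

Lemma mxinner1E (R : realType) (m : nat) (B : 'M[R]_m) : mxinner 1%:M B = \tr B.
Proof.
apply: eq_bigr => i _; rewrite (bigD1 i) //= mxE eqxx mul1r.
by rewrite big1 ?addr0 // => j; rewrite eq_sym mxE => /negPf ->; rewrite mul0r.
Qed.

Lemma mxinner1_gram (R : realType) (m : nat) (w : 'cV[R]_m) :
  mxinner 1%:M (w *m w^T) = sqnorm2 w.
Proof.
by rewrite mxinner1E; apply: eq_bigr => i _; rewrite mxE big_ord1 mxE expr2.
Qed.

Section Convexity.
Context {R : realType} {E : lmodType R}.

Lemma convex_setP (A : set E) :
  (forall x y t, 0 <= t <= 1 -> A x -> A y -> A (t *: x + (1 - t) *: y)) ->
  @convex_set R E A.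
Proof.
move=> convA x y t; rewrite !inE => Ax Ay.
by apply: (convA x y t%:num) => //; rewrite ge0 le1.
Qed.

Lemma convex_setI (A B : set E) :
  @convex_set R E A -> @convex_set R E B -> @convex_set R E (A `&` B)%classic.
Proof.
move=> convA convB x y t; rewrite !in_setI => /andP[Ax Bx] /andP[Ay By].
by rewrite convA ?convB.
Qed.

(** Equality suffices for both relaxed objectives: [W] stands in for the quadratic term, so they are
    linear in the lifted variables. *)
Lemma convex_functionP (f : E -> R) :
  (forall x y t, f (t *: x + (1 - t) *: y) = t * f x + (1 - t) * f y) ->
  @convex_function R E setT f.
Proof.
by move=> faff t x y _ _; rewrite convRE -faff le_eqVlt eqxx.
Qed.

End Convexity.

(** The defect of the quadratic map [w *m w^T] along a segment is a multiple of one Gram matrix. For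
    [t] in [0,1] its coefficient is nonnegative, which gives the Loewner concavity. *)
Lemma subgram_conv (R : realType) (p : nat) (w1 w2 : 'cV[R]_p) (W1 W2 : 'M_p)
    (t : R) :
  let w := t *: w1 + (1 - t) *: w2 in
  t *: W1 + (1 - t) *: W2 - w *m w^T =
  t *: (W1 - w1 *m w1^T) + (1 - t) *: (W2 - w2 *m w2^T)
  + (t * (1 - t)) *: ((w1 - w2) *m (w1 - w2)^T).
Proof. by apply/matrixP=> i j; rewrite !(mxE, big_ord1); ring. Qed.

Section Relaxation.
Context {R : realType} {n p : nat}.
Implicit Types (A : 'M[R]_(n, p)) (L : {set 'I_n}) (LL : {set {set 'I_n}}).

Lemma lifted_mx_conv A L (w1 w2 : 'cV_p) (W1 W2 : 'M_p) (z1 z2 : 'cV_n)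
    (g1 g2 : 'cV_#|L|) (t : R) :
  lifted_mx A (t *: w1 + (1 - t) *: w2) (t *: W1 + (1 - t) *: W2)
    (t *: z1 + (1 - t) *: z2) (t *: g1 + (1 - t) *: g2) =
  t *: lifted_mx A w1 W1 z1 g1 + (1 - t) *: lifted_mx A w2 W2 z2 g2.
Proof.
rewrite /lifted_mx !scale_block_mx add_block_mx; congr block_mx.
- rewrite !scale_scalar_mx -raddfD !mulr_sumr -big_split /=; congr _%:M.
  by apply: eq_bigr => i _; rewrite !mxE.
- by rewrite linearD !linearZ /= opprD !scalerN.
- by rewrite opprD !scalerN.
- set AL := rows_in L A.
  rewrite [(_ + _)^T]linearD !linearZ /= !(mulmxDr, mulmxDl) -!(scalemxAl, scalemxAr).
  (* With the products abstracted, the identity is affine entry by entry; the constant block [O] is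
     recovered because the weights sum to one. *)
  move: (ones *m _) (AL *m w1 *m _) (AL *m w2 *m _) => O B1 B2.
  move: (_ *m w1^T *m _) (_ *m w2^T *m _) (AL *m W1 *m _) (AL *m W2 *m _).
  by move=> C1 C2 D1 D2; apply/matrixP=> i j; rewrite !mxE; ring.
Qed.

Lemma gvecD LL (g1 g2 : gfamily R n LL) (L : {L | L \in LL}) :
  gvec (g1 + g2) L = gvec g1 L + gvec g2 L.
Proof. by apply/colP=> j; rewrite !mxE ffunE. Qed.

Lemma gvecZ LL (t : R) (g : gfamily R n LL) (L : {L | L \in LL}) :
  gvec (t *: g) L = t *: gvec g L.
Proof. by apply/colP=> j; rewrite !mxE ffunE. Qed.

Lemma lifted_mx_psd A L (w : 'cV_p) (z : 'cV_n) (c : R) :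
  c ^+ 2 <= \sum_(i in L) z i 0 ->
  psdmx (lifted_mx A w (w *m w^T) z (c *: (ones - rows_in L A *m w))).
Proof.
move=> c2_le; set u := ones - _; set s := \sum_(i in L) z i 0 in c2_le *.
pose v : 'cV[R]_(1 + #|L|) := col_mx (- c)%:M u.
pose e : 'cV[R]_(1 + #|L|) := col_mx 1%:M 0.
(* The upper left entry [s] exceeds the [c ^+ 2] supplied by [v] by exactly the coefficient of
   [e *m e^T]. *)
have -> : lifted_mx A w (w *m w^T) z (c *: u)
    = (s - c ^+ 2) *: (e *m e^T) + v *m v^T.
  rewrite /lifted_mx -/s !tr_col_mx !mul_col_row scale_block_mx add_block_mx.
  rewrite !tr_scalar_mx trmx0 !(mulmx0, mul0mx, scaler0, add0r).
  rewrite !(mul_scalar_mx, mul_mx_scalar, scale_scalar_mx) linearZ /=.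
  rewrite !scaleNr -raddfD /=; congr block_mx.
    by congr _%:M; ring.
  (* What remains is the lower right block, the expansion of [u *m u^T]. *)
  rewrite /u linearB /= trmx_mul mulmxBl !mulmxBr !mulmxA.
  by rewrite (addrAC (ones *m _)) opprD opprK addrA.
by apply: psdmxD; [apply: psdmxZ; rewrite ?subr_ge0 // |]; exact: psdmx_gram.
Qed.

Lemma relax_feasible_convex (a : 'I_n -> 'cV[R]_p) (y : 'I_n -> R) LL :
  @convex_set R _ (@relax_feasible R n p a y LL).
Proof.
apply: convex_setP => -[[w1 z1] [W1 g1]] [[w2 z2] [W2 g2]] t /andP[t0 t1].
move=> [L1 psd1 box1] [L2 psd2 box2].
have s0 : 0 <= 1 - t by rewrite subr_ge0.
rewrite /relax_feasible /=; split.
- move=> L; have [le1 lift1] := L1 L; have [le2 lift2] := L2 L.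
  rewrite gvecD !gvecZ lifted_mx_conv; split; last first.
    by apply: psdmxD; apply: psdmxZ.
  move=> j; have := ler_wpM2l t0 (le1 j); have := ler_wpM2l s0 (le2 j).
  rewrite mulmxDr -!scalemxAr; move: (_ *m w1) (_ *m w2) => b1 b2.
  rewrite !mxE => h2 h1.
  by lra.
- rewrite subgram_conv; apply: psdmxD; first by apply: psdmxD; apply: psdmxZ.
  by apply: psdmxZ (psdmx_gram _); rewrite mulr_ge0.
- move=> i; rewrite !mxE; have /andP[? ?] := box1 i; have /andP[? ?] := box2 i.
  by apply/andP; split; nra.
Qed.

(** Provides the bound [c ^+ 2 <= \sum_(i in L) z i 0] in the case [c = 1]. *)
Lemma sum_binary_ge1 L (z : 'cV[R]_n) :
  (forall i, z i 0 = 0 \/ z i 0 = 1) -> (exists2 i, i \in L & z i 0 = 1) ->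
  1 <= \sum_(i in L) z i 0.
Proof.
move=> zbin [i iL zi1]; rewrite (bigD1 i) //= zi1 lerDl sumr_ge0 // => j _.
by case: (zbin j) => ->.
Qed.

Lemma data_mx_mul (a : 'I_n -> 'cV[R]_p) (y : 'I_n -> R) (w : 'cV_p) i :
  (data_mx a y *m w) i 0 = y i * ((a i)^T *m w) 0 0.
Proof.
by rewrite !mxE mulr_sumr; apply: eq_bigr => j _; rewrite !mxE mulrA.
Qed.

Lemma relax_feasible_extension (a : 'I_n -> 'cV[R]_p) (y : 'I_n -> R) (M : R)
    LL (w : 'cV_p) (z : 'cV_n) :
  bigM_feasible a y M (w, z) ->
  exists g : gfamily R n LL, relax_feasible a y ((w, z), (w *m w^T, g)).
Proof.
move=> [zbin zcon]; pose A := data_mx a y.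
pose c (L : {set 'I_n}) : R := [exists i in L, z i 0 == 1]%:R.
pose g : gfamily R n LL :=
  [ffun x => c (val (tag x)) *
    (ones - rows_in (val (tag x)) A *m w) (tagged x) 0].
exists g; split; last 1 first.
- by move=> i; case: (zbin i) => ->; rewrite ?lexx ler01.
- move=> L.
  have -> : gvec g L = c (val L) *: (ones - rows_in (val L) A *m w).
    by apply/colP=> j; rewrite [LHS]mxE ffunE [RHS]mxE.
  split.
    move=> j; rewrite [leRHS]mxE /c; case: exists_inP => [_|noz].
      by rewrite mul1r.
    (* Here [c = 0], so the goal is that the entry of [u] at [j] is at most 0. *)
    have /negP z1 : ~ z (enum_val j) 0 == 1.
      by move=> z1; apply: noz; exists (enum_val j); rewrite ?enum_valP.
    rewrite mul0r [leLHS]mxE [X in _ + X]mxE [X in X - _]mxE subr_le0.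
    (* At [z = 0] the big-M term vanishes and the constraint bounds this row of [A *m w] below by 1;
       the value 1 is excluded by [z1]. *)
    have := zcon (enum_val j); case: (zbin (enum_val j)) => [->|z1'].
      rewrite mulr0 subr0 -data_mx_mul; congr (_ <= _).
      by rewrite /rows_in mul_rowsub_mx [RHS]mxE.
    by rewrite z1' eqxx in z1.
  apply: lifted_mx_psd; rewrite /c; case: exists_inP => [[i iL /eqP zi1]|_].
    by rewrite expr1n; apply: sum_binary_ge1 => //; exists i.
  by rewrite expr0n sumr_ge0 // => i _; case: (zbin i) => ->.
- by rewrite subrr; exact: psdmx0.
Qed.

End Relaxation.

(* M is arbitrary, hence in particular any sufficiently large number. *)
Theorem proposition10 (R : realType) (n p : nat) (lambda : R) (k : nat)
    (a : 'I_n -> 'cV[R]_p) (y : 'I_n -> R) (M : R)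
    (lambda_gt0 : 0 < lambda)
    (y_sign : forall i, y i = -1 \/ y i = 1)
    (LL : {set {set 'I_n}}) :
  convex_relaxation (relax_penalized a y lambda LL)
                    (bigM_penalized a y M lambda) /\
  convex_relaxation (relax_cardinality a y k LL)
                    (bigM_cardinality a y M k).
Proof.
have sum_conv (z1 z2 : 'cV[R]_n) (t : R) :
    \sum_(i < n) (t *: z1 + (1 - t) *: z2) i 0
    = t * (\sum_(i < n) z1 i 0) + (1 - t) * (\sum_(i < n) z2 i 0).
  by rewrite !mulr_sumr -big_split; apply: eq_bigr => i _; rewrite !mxE.
split; split.
- exact: relax_feasible_convex.
- apply: convex_functionP => -[[w1 z1] [W1 g1]] [[w2 z2] [W2 g2]] t /=.
  by rewrite sum_conv !mxinner1E mxtraceD !mxtraceZ; ring.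
- move=> [w z] /(@relax_feasible_extension _ _ _ _ _ _ LL)[g feas].
  (* The trace of [w *m w^T] is the squared norm of [w], so the two objective values coincide. *)
  by exists (w *m w^T, g); split=> //=; rewrite mxinner1_gram.
- apply: convex_setI; first exact: relax_feasible_convex.
  apply: convex_setP => -[[w1 z1] [W1 g1]] [[w2 z2] [W2 g2]] t /andP[t0 t1].
  by move=> /= card1 card2; rewrite sum_conv; nra.
- apply: convex_functionP => -[[w1 z1] [W1 g1]] [[w2 z2] [W2 g2]] t /=.
  by rewrite !mxinner1E mxtraceD !mxtraceZ.
- move=> [w z] [/(@relax_feasible_extension _ _ _ _ _ _ LL)[g feas] card].
  by exists (w *m w^T, g); split=> //=; rewrite mxinner1_gram.
Qed.
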